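(* Let $n\in\mathbb N$ be even, let $L,D>0$ and $k\in\mathbb N$. Let $\mathcal A$ be a consistent 1-SCLI algorithm over $\mathbb R^n$ or, more generally, any 1-SCLI algorithm such that $\mathbf C_0(\mathbf A)=I+\mathbf N(\mathbf A)\mathbf A$ for all full-rank $\mathbf A$ of the form $\begin{pmatrix}\mathbf 0&\mathbf M\\-\mathbf M^\top&\mathbf 0\end{pmatrix}$ with $\mathbf M\in\mathbb R^{n/2\times n/2}$; assume $\mathcal A$ is initialized at $\mathbf z^{(0)}=\mathbf 0$. Suppose that the inversion matrix $\mathbf N(\cdot)$ of $\mathcal A$ is a polynomial of degree at most $k-1$ with real-valued coefficients. Then for every $T\in\mathbb N$, $T\ge 1$: 1. With $\mathcal L^{\mathrm{Ham}}_F(\mathbf z)=\|F(\mathbf z)\|^2$ for $F\in\mathcal F^{\mathrm{bil}}_{n,L,D}$, one has $\mathrm{IC}_{n,L,D}(\mathcal A,\mathcal L^{\mathrm{Ham}};T)\ge \dfrac{L^2D^2}{20Tk^2}$. 2. With $\mathcal L^{\mathrm{Gap}}_F(\mathbf z)=\sup_{\mathbf y':\|\mathbf y'-\mathbf y^*\|\le D} f(\mathbf x,\mathbf y')-\inf_{\mathbf x':\|\mathbf x'-\mathbf x^*\|\le D} f(\mathbf x',\mathbf y)$ for $F=F_f\in\mathcal F^{\mathrm{bil}}_{n,L,D}$ and $\mathbf z=(\mathbf x,\mathbf y)$, one has $\mathrm{IC}_{n,L,D}(\mathcal A,\mathcal L^{\mathrm{Gap}};T)\ge \dfrac{LD^2}{k\sqrt{20T}}$.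 3. With $\mathcal L^{\mathrm{Func}}_F(\mathbf z)=|f(\mathbf x,\mathbf y)-f(\mathbf x^*,\mathbf y^* )|$ for $F=F_f\in\mathcal F^{\mathrm{bil}}_{n,L,D}$ and $\mathbf z=(\mathbf x,\mathbf y)$, one has $$\max\left\{\mathrm{IC}_{n,L,D}(\mathcal A,\mathcal L^{\mathrm{Func}};T),\ \mathrm{IC}_{n,L,D}(\mathcal A,\mathcal L^{\mathrm{Func}};2T)\right\}\ge \frac{LD^2}{36k\sqrt T}.$$
   Context: Norms of vectors are Euclidean. For even $n$, consider bilinear functions $f(\mathbf x,\mathbf y)=\mathbf x^\top\mathbf M\mathbf y+\mathbf b_1^\top\mathbf x+\mathbf b_2^\top\mathbf y$ with $\mathbf x,\mathbf y,\mathbf b_1,\mathbf b_2\in\mathbb R^{n/2}$ and $\mathbf M\in\mathbb R^{n/2\times n/2}$. The associated operator $F_f:\mathbb R^n\to\mathbb R^n$, $F_f(\mathbf x,\mathbf y)=(\nabla_{\mathbf x}f(\mathbf x,\mathbf y),-\nabla_{\mathbf y}f(\mathbf x,\mathbf y))$, is $F_f(\mathbf z)=\mathbf A\mathbf z+\mathbf b$ with $\mathbf z=(\mathbf x,\mathbf y)$, $\mathbf A=\begin{pmatrix}\mathbf 0&\mathbf M\\-\mathbf M^\top&\mathbf 0\end{pmatrix}$, $\mathbf b=\begin{pmatrix}\mathbf b_1\\-\mathbf b_2\end{pmatrix}$. $\mathcal F^{\mathrm{bil}}_{n,L,D}$ is the set of all $L$-Lipschitz operators $F=F_f$ of this form for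 which $\mathbf M$ (hence $\mathbf A$) has full rank and $\|\mathbf A^{-1}\mathbf b\|=D$. For such $F$, $\mathbf z^*=(\mathbf x^*,\mathbf y^* )=-\mathbf A^{-1}\mathbf b$ is the unique global saddle point of $f$. A 1-SCLI (1-stationary canonical linear iterative) algorithm $\mathcal A$ over $\mathbb R^n$ is given by mappings $\mathbf C_0,\mathbf N:\mathbb R^{n\times n}\to\mathbb R^{n\times n}$ and an initial vector $\mathbf z^{(0)}\in\mathbb R^n$; on $F(\mathbf z)=\mathbf A\mathbf z+\mathbf b$ it produces the iterates $\mathbf z^{(t)}=\mathbf C_0(\mathbf A)\mathbf z^{(t-1)}+\mathbf N(\mathbf A)\mathbf b$ for $t\ge1$, denoted $\mathbf z^{(t)}(F)$. $\mathbf N$ is called the inversion matrix; that $\mathbf N(\cdot)$ is a polynomial of degree at most $k-1$ with real coefficients means $\mathbf N(\mathbf A)=\sum_{j=0}^{k-1}c_j\mathbf A^j$ for fixed scalars $c_j\in\mathbb R$. The description of $\mathcal A$ may depend on $L,D$. $\mathcal A$ is consistent with respect to an invertible matrix $\mathbf A$ if for every $\mathbf b\in\mathbb R^n$ the iterates $\mathbf z^{(t)}$ converge to $-\mathbf A^{-1}\mathbf b$; it is consistent if it is consistent with respect to every full-rank $\mathbf A$ of the block form above. Given loss functions $\mathcal L_F:\mathbb R^n\to\mathbb R_{\ge0}$ for each $F\in\mathcal F^{\mathrm{bil}}_{n,L,D}$, the iteration complexity at time $T$ is $\mathrm{IC}_{n,L,D}(\mathcal A,\mathcal L;T)=\sup_{F\in\mathcal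 F^{\mathrm{bil}}_{n,L,D}}\mathcal L_F(\mathbf z^{(T)}(F))$ (possibly $+\infty$). *)

(* Defs.v *)
(* The real numbers are an arbitrary R : realType.
   The even dimension is n = m + m, so R^n is 'cV[R]_(m + m) and
   z = (x, y) has x = usubmx z and y = dsubmx z. *)
From HB Require Import structures.
From mathcomp Require Import all_boot all_order all_algebra.
From mathcomp Require Import all_classical all_reals all_analysis.
Set Implicit Arguments.
Unset Strict Implicit.
Unset Printing Implicit Defensive.
Import Order.TTheory GRing.Theory Num.Theory.
Import numFieldNormedType.Exports.

Local Open Scope classical_set_scope.
Local Open Scope ring_scope.

(* The library norm `|v| on matrices is the sup norm. *)
Definition enorm (R : realType) (n : nat) (v : 'cV[R]_n) : R :=
  Num.sqrt (\sum_(i < n) v i 0 ^+ 2).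

Definition elipschitz (R : realType) (n : nat) (L : R)
    (F : 'cV[R]_n -> 'cV[R]_n) : Prop :=
  forall z w, enorm (F z - F w) <= L * enorm (z - w).

Definition grad (R : realType) (n : nat) (phi : 'cV[R]_n -> R)
    (x : 'cV[R]_n) : 'cV[R]_n :=
  \col_i derive1 (fun t : R => phi (x + t *: delta_mx i 0)) 0.

Record bilinear (R : realType) (m : nat) := Bilinear {
  bil_M : 'M[R]_m ;
  bil_b1 : 'cV[R]_m ;
  bil_b2 : 'cV[R]_m }.

Definition bil_eval (R : realType) (m : nat) (f : bilinear R m)
    (x y : 'cV[R]_m) : R :=
  (x^T *m bil_M f *m y) 0 0 + ((bil_b1 f)^T *m x) 0 0
  + ((bil_b2 f)^T *m y) 0 0.

Definition saddle_mx (R : realType) (m : nat) (M : 'M[R]_m) : 'M[R]_(m + m) :=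
  block_mx 0 M (- M^T) 0.

Definition bil_A (R : realType) (m : nat) (f : bilinear R m) : 'M[R]_(m + m) :=
  saddle_mx (bil_M f).

Definition bil_b (R : realType) (m : nat) (f : bilinear R m) : 'cV[R]_(m + m) :=
  col_mx (bil_b1 f) (- bil_b2 f).

Definition bil_op (R : realType) (m : nat) (f : bilinear R m)
    (z : 'cV[R]_(m + m)) : 'cV[R]_(m + m) :=
  let x := usubmx z in let y := dsubmx z in
  col_mx (grad (fun x' => bil_eval f x' y) x)
         (- grad (fun y' => bil_eval f x y') y).

Lemma grad_affine (R : realType) (n : nat) (a x : 'cV[R]_n) (c : R)
    (phi : 'cV[R]_n -> R) :
  (forall v, phi v = (a^T *m v) 0 0 + c) -> grad phi x = a.
Proof.
move=> phiE; apply/colP => i; rewrite mxE.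
have -> : (fun t : R => phi (x + t *: delta_mx i 0)) =
          (fun t : R => t * a i 0 + phi x).
  apply/funext => t; rewrite !phiE mulmxDr -scalemxAr -colE !mxE.
  by rewrite addrAC addrC addrA.
have -> : (fun t : R => t * a i 0 + phi x) =
          (a i 0 \*: (@id R)) + cst (phi x).
  by apply/funext => t; rewrite mulrC.
have d1 : is_derive (0 : R) (1 : R) (@id R) 1 := is_derive_id _ _.
have d2 : is_derive (0 : R) (1 : R) (cst (phi x) : R -> R) 0.
  exact: is_derive_cst.
rewrite derive1E (@derive_val _ _ _ _ _ _ _ (is_deriveD (is_deriveZ (a i 0) d1) d2)).
by rewrite addr0 [_ *: _]mulr1.
Qed.

Lemma bil_opE (R : realType) (m : nat) (f : bilinear R m)
    (z : 'cV[R]_(m + m)) :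
  bil_op f z = bil_A f *m z + bil_b f.
Proof.
rewrite /bil_op /bil_A /bil_b /saddle_mx /=.
rewrite -[in RHS](vsubmxK z) mul_block_col !mul0mx add0r addr0 add_col_mx.
rewrite mulNmx -opprD.
set x := usubmx z; set y := dsubmx z.
congr (col_mx _ (- _)).
- apply: (@grad_affine _ _ _ _ (((bil_b2 f)^T *m y) 0 0)) => v.
  rewrite /bil_eval raddfD /= mulmxDl [X in _ = X + _]mxE; congr (_ + _ + _).
  by rewrite -[in RHS](trmxK v) -trmx_mul [RHS]mxE mulmxA.
- apply: (@grad_affine _ _ _ _ (((bil_b1 f)^T *m x) 0 0)) => v.
  rewrite /bil_eval raddfD /= trmx_mul trmxK mulmxDl [X in _ = X + _]mxE.
  by rewrite addrAC.
Qed.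

Definition bil_zstar (R : realType) (m : nat) (f : bilinear R m) :
    'cV[R]_(m + m) :=
  - (invmx (bil_A f) *m bil_b f).

(* The operator F_f determines M, b1 and b2, so a set of operators F = F_f is
   encoded as a set of functions f, and a loss L_F is indexed by f. *)
Definition bil_class (R : realType) (m : nat) (L D : R) : set (bilinear R m) :=
  [set f | [/\ elipschitz L (bil_op f),
               \rank (bil_M f) = m &
               enorm (invmx (bil_A f) *m bil_b f) = D]].

Record scli (R : realType) (n : nat) := Scli {
  scli_C0 : 'M[R]_n -> 'M[R]_n ;
  scli_N : 'M[R]_n -> 'M[R]_n ;
  scli_z0 : 'cV[R]_n }.

Fixpoint scli_iter (R : realType) (n : nat) (alg : scli R n) (A : 'M[R]_n)
    (b : 'cV[R]_n) (t : nat) : 'cV[R]_n :=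
  if t is t'.+1
  then scli_C0 alg A *m scli_iter alg A b t' + scli_N alg A *m b
  else scli_z0 alg.

Definition consistent_wrt (R : realType) (n : nat) (alg : scli R n)
    (A : 'M[R]_n) : Prop :=
  forall b : 'cV[R]_n, scli_iter alg A b @ \oo --> - (invmx A *m b).

Definition consistent (R : realType) (m : nat) (alg : scli R (m + m)) : Prop :=
  forall M : 'M[R]_m, \rank (saddle_mx M) = (m + m)%N ->
    consistent_wrt alg (saddle_mx M).

Definition inversion_poly (R : realType) (n : nat) (alg : scli R n) (k : nat) :
    Prop :=
  exists c : 'I_k -> R,
    forall A : 'M[R]_n, scli_N alg A = \sum_(j < k) c j *: A ^+ j.

Definition IC (R : realType) (m : nat) (L D : R) (alg : scli R (m + m))
    (loss : bilinear R m -> 'cV[R]_(m + m) -> R) (T : nat) : \bar R :=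
  ereal_sup [set (loss f (scli_iter alg (bil_A f) (bil_b f) T))%:E |
             f in bil_class L D].

Definition loss_ham (R : realType) (m : nat) (f : bilinear R m)
    (z : 'cV[R]_(m + m)) : R :=
  enorm (bil_op f z) ^+ 2.

(* For D >= 0 both sets below are nonempty and bounded (f is affine in each
   argument), so sup and inf do not take their default value 0. *)
Definition loss_gap (R : realType) (m : nat) (D : R) (f : bilinear R m)
    (z : 'cV[R]_(m + m)) : R :=
  sup [set bil_eval f (usubmx z) y' |
       y' in [set y' | enorm (y' - dsubmx (bil_zstar f)) <= D]]
  - inf [set bil_eval f x' (dsubmx z) |
         x' in [set x' | enorm (x' - usubmx (bil_zstar f)) <= D]].

Definition loss_func (R : realType) (m : nat) (f : bilinear R m)
    (z : 'cV[R]_(m + m)) : R :=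
  `|bil_eval f (usubmx z) (dsubmx z)
    - bil_eval f (usubmx (bil_zstar f)) (dsubmx (bil_zstar f))|.

(* Main.v *)
(* For M = nu I the saddle matrix is A = nu J with J^2 = -1, so matrices in A act
   as complex numbers, and C0 (A) = 1 + N (A) A acts as q (i nu), where the real
   part of q (i nu) is p (nu^2) for a real polynomial p of degree at most k with
   p (0) = 1.  The error is z_T - z* = - q (i nu)^T z*, so all three losses are
   bounded below by powers of nu and |p (nu^2)|^T, once z* is rotated so that the
   error has x and y components equal.  Chebyshev's extremal property (among
   polynomials of degree k with p (0) = 1, the rescaled T_k is smallest on
   [y0, L^2]), for y0 = L^2 / (5 T k^2), yields some nu with nu^2 >= y0
   and |p (nu^2)|^(2 T) >= 1/4. *)
Require Import Defs.
From mathcomp Require Import all_boot all_order all_algebra.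
From mathcomp Require Import all_classical all_reals all_analysis.
From mathcomp Require Import ring lra.
Set Implicit Arguments.
Unset Strict Implicit.
Unset Printing Implicit Defensive.
Import Order.TTheory GRing.Theory Num.Theory.
Import numFieldNormedType.Exports.
Local Open Scope classical_set_scope.
Local Open Scope ring_scope.

(** * Chebyshev polynomials and their extremal property *)

(** Each sign change yields a root by the intermediate value theorem. Strictness at the left end of
    the interval keeps the induction going: a new root lies below [x n], all earlier ones above it,
    so they are distinct. *)
Lemma alternating_roots (R : rcfType) (p : {poly R}) (x : nat -> R) (n : nat) :
    (forall j, (j < n)%N -> x j.+1 < x j) ->
    (forall j, (j <= n)%N -> 0 < (-1) ^+ j * p.[x j]) ->
  exists rs : seq R, [/\ size rs = n, uniq rs, all (root p) rs &
    all (fun r => x n < r <= x 0) rs].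
Proof.
elim: n => [|n IH] xdec px; first by exists [::].
have [||rs [szrs urs rrs xrs]] := IH.
- by move=> j jn; apply: xdec; rewrite ltnS ltnW.
- by move=> j jn; apply: px; rewrite leqW.
have xlt := xdec n (ltnSn n).
have px1 := px n (leqnSn n); have px2 := px n.+1 (leqnn n.+1).
have [||r /andP[xr rx] rootr] := @poly_ivt R ((-1) ^+ n *: p) (x n.+1) (x n).
- exact: ltW.
- rewrite !hornerZ (ltW px1) andbT.
  by move: px2; rewrite exprS mulN1r mulNr oppr_gt0 => /ltW.
have signP : ((-1) ^+ n : R) != 0 by rewrite signr_eq0.
rewrite rootE hornerZ mulf_eq0 (negPf signP) /= in rootr.
have x0n : x n <= x 0.
  elim: n {IH px rrs xrs szrs px1 px2 xlt rx xr rootr signP} xdec => // n IHn xdec.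
  rewrite (le_trans (ltW (xdec n _))) ?IHn// => j jn; apply: xdec.
  exact: ltnW.
have rne : r != x n.
  apply/eqP => rE; move: px1; rewrite -rE (eqP rootr) mulr0 ltxx //.
have rne' : r != x n.+1.
  apply/eqP => rE; move: px2; rewrite -rE (eqP rootr) mulr0 ltxx //.
have rx' : r < x n by rewrite lt_neqAle rne.
have xr' : x n.+1 < r by rewrite lt_neqAle eq_sym rne'.
exists (r :: rs); split => /=.
- by rewrite szrs.
- rewrite urs andbT; apply/negP => /(allP xrs) /andP[] /(lt_trans rx').
  by rewrite ltxx.
- by rewrite rootE rootr rrs.
- rewrite xr' (le_trans (ltW rx') x0n) /=.
  apply/allP => s /(allP xrs) /andP[xs ->]; rewrite andbT.
  exact: lt_trans xs.
Qed.

(** The Chebyshev polynomials $T_n$ of the first kind. The recurrence gives access to their values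
    beyond $1$, where the formula with the cosine does not apply. *)
Fixpoint cheb (R : comNzRingType) (n : nat) : {poly R} :=
  match n with
  | 0 => 1
  | n1.+1 => match n1 with
             | 0 => 'X
             | n2.+1 => 2%:R *: 'X * cheb R n1 - cheb R n2
             end
  end.

Lemma size_cheb (R : comNzRingType) (n : nat) : (size (cheb R n) <= n.+1)%N.
Proof.
suff: (size (cheb R n) <= n.+1)%N /\ (size (cheb R n.+1) <= n.+2)%N by case.
elim: n => [|n [IH1 IH2]]; first by rewrite /= size_poly1 size_polyX.
split=> //; rewrite [cheb R n.+2]/=.
rewrite (leq_trans (size_polyD _ _)) // geq_max size_polyN.
rewrite (leq_trans IH1) ?andbT; last exact: leq_trans (leqnSn _) _.
rewrite -scalerAl (leq_trans (size_scale_leq _ _)) //.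
rewrite mulrC (leq_trans (size_polyMleq _ _)) //.
by rewrite size_polyX addn2 /=.
Qed.

Lemma cheb_cos (R : realType) (n : nat) (t : R) :
  (cheb R n).[cos t] = cos (n%:R * t).
Proof.
suff: (cheb R n).[cos t] = cos (n%:R * t) /\
      (cheb R n.+1).[cos t] = cos (n.+1%:R * t) by case.
elim: n => [|n [IH1 IH2]]; first by rewrite /= hornerX hornerC mul0r cos0 mul1r.
split=> //; rewrite [cheb R n.+2]/= hornerD hornerN hornerM hornerZ hornerX.
rewrite -/(cheb R n.+1) IH1 IH2.
have -> : n.+2%:R * t = n.+1%:R * t + t by rewrite -natr1 mulrDl mul1r.
have -> : n%:R * t = n.+1%:R * t - t by rewrite -natr1 mulrDl mul1r addrK.
by rewrite cosB cosD; ring.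
Qed.

(* Consecutive ratios satisfy rho_{n+1} = 2 (1 + d) - 1 / rho_n, whence
   rho_n <= 1 + (2 n + 1) d. *)
Lemma cheb_ratio (R : realFieldType) (n : nat) (d : R) : 0 < d ->
  0 < (cheb R n).[1 + d] /\
  (cheb R n).[1 + d] <= (cheb R n.+1).[1 + d]
    <= (1 + (2 * n + 1)%:R * d) * (cheb R n).[1 + d].
Proof.
move=> d0; elim: n => [|n [c0 /andP[c1 c2]]].
  rewrite /= hornerX hornerC ltr01 muln0 add0n mulr1 mul1r lexx andbT.
  by split=> //; rewrite lerDl ltW.
have c1' := lt_le_trans c0 c1; split=> //.
rewrite [cheb R n.+2]/= hornerD hornerN hornerM hornerZ hornerX -/(cheb R n.+1).
set u := (cheb R n).[_] in c0 c1 c2 *.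
set v := (cheb R n.+1).[_] in c1 c2 c1' *.
have vd : 0 < v * d by rewrite mulr_gt0.
apply/andP; split; first by nra.
have -> : (2 * n.+1 + 1)%:R = (2 * n + 1)%:R + 2 :> R.
  by rewrite !natrD !natrM -natr1; ring.
set a := (2 * n + 1)%:R in c2 *.
have a0 : 0 <= a by rewrite ler0n.
have ad : 0 <= a * d by rewrite mulr_ge0 // ltW.
(* The recurrence turns the upper bound into $v - u \le a d v$. It follows from $v \le (1 + a d) u$
   and $(1 - a d)(1 + a d) \le 1$ if $a d \le 1$; otherwise the left side is negative. *)
suff : (1 - a * d) * v <= u by nra.
have [ad1|ad1] := leP (a * d) 1; last by nra.
rewrite (le_trans (ler_wpM2l _ c2)) ?subr_ge0 //.
rewrite mulrA.
rewrite (_ : (1 - a * d) * (1 + a * d) = 1 - (a * d) ^+ 2); last by ring.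
rewrite ler_piMl ?(ltW c0) // gerBl sqr_ge0 //.
Qed.

(** Each ratio bound $1 + (2j + 1) d$ is at most $e^{(2j+1)d}$, and the first $n$ odd numbers add up
    to $n^2$. *)
Lemma cheb_le_expR (R : realType) (n : nat) (d : R) : 0 < d ->
  (cheb R n).[1 + d] <= expR (n%:R ^+ 2 * d).
Proof.
move=> d0; elim: n => [|n IH].
  by rewrite /= hornerC expr0n mul0r expR0.
have [c0 /andP[_ /le_trans ->//]] := cheb_ratio n d0.
have -> : n.+1%:R ^+ 2 * d = (2 * n + 1)%:R * d + n%:R ^+ 2 * d :> R.
  by rewrite -natr1 natrD natrM; ring.
rewrite expRD ler_pM ?(ltW c0) ?expR_ge1Dx //.
by rewrite addr_ge0 // mulr_ge0 // ltW.
Qed.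

(** Were the conclusion false, $h = T_k - T_k(1+d)\, p$ would have the alternating signs of $T_k$ at
    the $k+1$ points $\cos(j\pi/k)$. This gives $k$ roots in $[-1, 1]$, and $1 + d$ is one more, too
    many for a nonzero polynomial of degree at most $k$. *)
Lemma cheb_extremal (R : realType) (k : nat) (p : {poly R}) (d : R) :
    0 < d -> (size p <= k.+1)%N -> p.[1 + d] = 1 ->
  exists2 x, -1 <= x <= 1 & 1 <= `|p.[x]| * (cheb R k).[1 + d].
Proof.
move=> d0 szp p1; apply: contrapT => Hn.
have {}Hn x : -1 <= x <= 1 -> `|p.[x]| * (cheb R k).[1 + d] < 1.
  by move=> x1; rewrite ltNge; apply/negP => ?; apply: Hn; exists x.
have [t0 _] := cheb_ratio k d0; set tau := (cheb R k).[1 + d] in t0 Hn.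
pose h := cheb R k - tau *: p.
(* For $k = 0$ the quotient is $0$ by convention, and the only node is $\cos 0 = 1$. *)
pose x (j : nat) : R := cos (j%:R * (pi / k%:R)).
have arg0pi j : (j <= k)%N -> j%:R * (pi / k%:R) \in `[0, (pi : R)].
  move=> jk; rewrite in_itv /= mulr_ge0 ?divr_ge0 ?pi_ge0 //=.
  case: k {h x szp Hn t0 tau} jk => [|k] jk; first by rewrite invr0 !mulr0 pi_ge0.
  by rewrite mulrCA ler_piMr ?pi_ge0 // ler_pdivrMr ?ltr0n // mul1r ler_nat.
have [|| rs [szrs urs rrs xrs]] := @alternating_roots R h x k.
- move=> j jk; rewrite /x ltr_cos ?arg0pi // 1?ltnW //.
  rewrite ltr_pM2r ?ltr_nat // divr_gt0 ?pi_gt0 // ltr0n.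
  exact: leq_ltn_trans jk.
- move=> j jk; rewrite /h hornerD hornerN hornerZ {1}/x cheb_cos.
  have xj : -1 <= x j <= 1 by rewrite cos_geN1 cos_le1.
  have := Hn _ xj; rewrite -/(x j).
  have -> : cos (k%:R * (j%:R * (pi / k%:R))) = (-1) ^+ j :> R.
    case: (posnP k) jk => [->|k0 jk].
      by rewrite leqn0 => /eqP ->; rewrite mul0r cos0.
    rewrite mulrCA [k%:R * _]mulrC divfK ?pnatr_eq0 -?lt0n //.
    elim: j {jk xj} => [|j IH]; first by rewrite mul0r cos0.
    by rewrite -natr1 mulrDl mul1r cosDpi IH exprS mulN1r.
  rewrite mulrBr -expr2 sqrr_sign => H.
  rewrite subr_gt0 (le_lt_trans _ H) //.
  by rewrite (le_trans (ler_norm _)) // normrM normr_sign mul1r normrM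
    (gtr0_norm t0) mulrC.
have hd : root h (1 + d) by rewrite rootE /h hornerD hornerN hornerZ p1 mulr1 subrr.
(* At $1$ the two terms of $h$ cannot cancel: $T_k(1) = 1$, while [tau] times $|p(1)|$ is below
   $1$. *)
have h0 : h != 0.
  apply/eqP => h0; have I1 : -1 <= (1 : R) <= 1 by rewrite lexx andbT; lra.
  have := Hn _ I1.
  have : h.[1] = 0 by rewrite h0 horner0.
  rewrite /h hornerD hornerN hornerZ -{1}(@cos0 R) cheb_cos mulr0 cos0.
  move/eqP; rewrite subr_eq0 => /eqP H.
  by rewrite -(gtr0_norm t0) -normrM mulrC -H normr1 ltxx.
have := @max_poly_roots _ h (1 + d :: rs) h0.
rewrite /= hd rrs urs andbT => /(_ isT).
have -> : 1 + d \notin rs.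
  apply/negP => /(allP xrs) /andP[_]; rewrite /x mul0r cos0.
  by rewrite gerDl leNgt d0.
move=> /(_ isT); rewrite szrs => H.
have : (size h <= k.+1)%N.
  rewrite (leq_trans (size_polyD _ _)) // geq_max size_cheb size_polyN.
  by rewrite (leq_trans (size_scale_leq _ _)).
by rewrite leqNgt H.
Qed.

(** From $e^{-1/2} \ge 1 - 1/2$ one gets $e^{1/2} \le 2$. *)
Lemma expR1_le4 (R : realType) : expR 1 <= 4 :> R.
Proof.
have e : 1 / 2 <= expR (- (1 / 2)) :> R.
  by apply: le_trans (expR_ge1Dx _); lra.
have -> : 1 = 1 / 2 + 1 / 2 :> R by lra.
rewrite expRD; rewrite expRN in e.
have e0 : 0 < expR (1 / 2) :> R by rewrite expR_gt0.
have e2 : expR (1 / 2) <= 2 :> R.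
  rewrite -(ler_pM2l (_ : 0 < 1 / 2 * (expR (1 / 2))^-1)); last first.
    by rewrite mulr_gt0 ?invr_gt0 //; lra.
  by rewrite divfK ?gt_eqF // mulrAC -mulrA mulrCA; lra.
nra.
Qed.

(* The affine map sending [y0, B] to [-1, 1], reversed, with
   y0 = B / (5 N k^2), sends 0 to 1 + d with d <= 1 / (2 N k^2); hence
   T_k (1 + d) ^ (2 N) <= e <= 4. *)
Lemma poly_power_lower_bound (R : realType) (k N : nat) (p : {poly R}) (B : R) :
    (0 < k)%N -> (0 < N)%N -> 0 < B -> (size p <= k.+1)%N -> p.[0] = 1 ->
  exists2 y, 0 < y <= B & B / (20%:R * N%:R * k%:R ^+ 2) <= y * (p.[y] ^+ 2) ^+ N.
Proof.
move=> k0 N0 B0 szp p0.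
pose K : R := N%:R * k%:R ^+ 2.
have K1 : 1 <= K by rewrite /K -natrX -natrM ler1n muln_gt0 N0 expn_gt0 k0.
have Kgt0 : 0 < K by exact: lt_le_trans K1.
pose y0 : R := B / (5 * K).
have y0gt0 : 0 < y0 by rewrite divr_gt0 // mulr_gt0.
have y0E : y0 * K * 5 = B by rewrite /y0; field; rewrite gt_eqF.
have y0B : y0 < B by rewrite -y0E; nra.
pose d : R := 2 * y0 / (B - y0).
have By0 : 0 < B - y0 by rewrite subr_gt0.
have d0 : 0 < d by rewrite divr_gt0 // mulr_gt0.
(* As $B = 5 K y_0$, this says $4 K y_0 \le (5 K - 1) y_0$, that is $K \ge 1$. Hence the factor $5$
   in [y0]. *)
have dK : d * (2 * K) <= 1.
  rewrite /d mulrAC ler_pdivrMr // mul1r.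
  have : y0 <= y0 * K by rewrite ler_peMr // ltW.
  rewrite -y0E; nra.
(* The inverse affine map: $g(-1) = B$, $g(1) = y_0$ and $g(1 + d) = 0$, so $p \circ g$ takes the
   value $1$ at $1 + d$. *)
pose g : {poly R} := ((B + y0) / 2)%:P - ((B - y0) / 2) *: 'X.
have gE x : g.[x] = (B + y0) / 2 - (B - y0) / 2 * x.
  by rewrite /g hornerD hornerN hornerZ hornerX hornerC.
have szg : (size g <= 2)%N.
  rewrite (leq_trans (size_polyD _ _)) // geq_max size_polyN.
  rewrite (leq_trans (size_polyC_leq1 _)) //.
  by rewrite (leq_trans (size_scale_leq _ _)) // size_polyX.
have [||x /andP[x1 x2]] := @cheb_extremal R k (p \Po g) d d0.
- rewrite (leq_trans (size_comp_poly_leq _ _)) // ltnS.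
  case: (posnP (size g)) => [->|sg]; first by rewrite muln0.
  rewrite (leq_trans (leq_mul (leqnn _) (_ : ((size g).-1 <= 1)%N))) //.
    by rewrite -ltnS prednK.
  by rewrite muln1 -subn1 leq_subLR add1n.
- rewrite horner_comp gE (_ : _ - _ = 0) // /d; field.
  by rewrite gt_eqF.
rewrite horner_comp; set y := g.[x] => Hy.
have yE : y = (B + y0) / 2 - (B - y0) / 2 * x by rewrite /y gE.
have yy0 : y0 <= y by rewrite yE; nra.
have yB : y <= B by rewrite yE; nra.
have y_gt0 : 0 < y by exact: lt_le_trans yy0.
exists y; first by rewrite y_gt0.
set c := (cheb R k).[1 + d] in Hy.
have [c0 _] := cheb_ratio k d0; rewrite -/c in c0.
have cN : (c ^+ 2) ^+ N <= 4.
  rewrite -exprM (le_trans _ (expR1_le4 R)) //.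
  rewrite (le_trans (lerXn2r _ _ _ (cheb_le_expR k d0))) ?nnegrE ?expR_ge0 ?(ltW c0) //.
  rewrite -expRM_natl ler_expR natrM (le_trans _ dK) //.
  by rewrite /K le_eqVlt; apply/orP; left; apply/eqP; ring.
have pc : 1 <= (p.[y] ^+ 2) ^+ N * (c ^+ 2) ^+ N.
  rewrite -exprMn -exprMn exprn_ege1 // -real_normK ?num_real //.
  by rewrite exprn_ege1 // normrM (gtr0_norm c0).
have pN : 1 <= (p.[y] ^+ 2) ^+ N * 4.
  by rewrite (le_trans pc) // ler_wpM2l // exprn_ge0 // sqr_ge0.
(* The constant $20$ is the $5$ in [y0] times the bound $4$ on $e$. *)
have -> : B / (20%:R * N%:R * k%:R ^+ 2) = y0 / 4.
  by rewrite /y0 /K; field; rewrite !pnatr_eq0 -!lt0n k0 N0.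
nra.
Qed.

(** * Euclidean norm *)

Lemma enormZ (R : realType) (n : nat) (a : R) (v : 'cV[R]_n) :
  enorm (a *: v) = `|a| * enorm v.
Proof.
rewrite /enorm -sqrtr_sqr -sqrtrM ?sqr_ge0 //; congr Num.sqrt.
by rewrite big_distrr; apply: eq_bigr => i _; rewrite mxE exprMn.
Qed.

Lemma enormN (R : realType) (n : nat) (v : 'cV[R]_n) : enorm (- v) = enorm v.
Proof. by rewrite -scaleN1r enormZ normrN1 mul1r. Qed.

Lemma enorm_sqr (R : realType) (n : nat) (v : 'cV[R]_n) :
  enorm v ^+ 2 = \sum_i v i 0 ^+ 2.
Proof. by rewrite sqr_sqrtr // sumr_ge0 // => i _; rewrite sqr_ge0. Qed.

Lemma enorm_ge0 (R : realType) (n : nat) (v : 'cV[R]_n) : 0 <= enorm v.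
Proof. exact: sqrtr_ge0. Qed.

Lemma enorm_col_mx_sqr (R : realType) (n1 n2 : nat) (u : 'cV[R]_n1)
    (v : 'cV[R]_n2) :
  enorm (col_mx u v) ^+ 2 = enorm u ^+ 2 + enorm v ^+ 2.
Proof.
rewrite !enorm_sqr big_split_ord; congr (_ + _); apply: eq_bigr => i _.
  by rewrite col_mxEu.
by rewrite col_mxEd.
Qed.

Lemma enorm_delta_mx (R : realType) (n : nat) (i : 'I_n) :
  enorm (delta_mx i 0 : 'cV[R]_n) = 1.
Proof.
rewrite /enorm (bigD1 i) //= mxE !eqxx expr1n big1 ?addr0 ?sqrtr1 // => j ji.
by rewrite mxE (negPf ji) expr0n.
Qed.

Lemma coord_le_enorm (R : realType) (n : nat) (i : 'I_n) (v : 'cV[R]_n) :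
  `|v i 0| <= enorm v.
Proof.
rewrite -sqrtr_sqr ler_sqrt ?sumr_ge0 // => [|j _]; last exact: sqr_ge0.
by rewrite (bigD1 i) //= lerDl sumr_ge0 // => j _; exact: sqr_ge0.
Qed.

(** * The complex structure $J$ *)

(** The standard symplectic matrix $J$, which stands for the imaginary unit. *)
Definition symp (R : realType) (m : nat) : 'M[R]_(m + m) := saddle_mx 1%:M.

Lemma saddle_scalar (R : realType) (m : nat) (nu : R) :
  saddle_mx (nu%:M : 'M[R]_m) = nu *: symp R m.
Proof.
by rewrite /symp /saddle_mx scale_block_mx !scaler0 scalerN tr_scalar_mx trmx1
  scalemx1.
Qed.

Lemma symp_sqr (R : realType) (m : nat) : symp R m *m symp R m = - 1%:M.
Proof.
rewrite /symp /saddle_mx trmx1 mulmx_block !mul0mx !mulmx0 !addr0 !add0r.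
by rewrite mulmx1 mul1mx scalar_mx_block opp_block_mx !oppr0.
Qed.

Lemma symp_col_mx (R : realType) (m : nat) (u v : 'cV[R]_m) :
  symp R m *m col_mx u v = col_mx v (- u).
Proof.
by rewrite /symp /saddle_mx trmx1 mul_block_col !mul0mx add0r addr0 mulNmx
  !mul1mx.
Qed.

Lemma enorm_symp (R : realType) (m : nat) (z : 'cV[R]_(m + m)) :
  enorm (symp R m *m z) = enorm z.
Proof.
apply/eqP; rewrite -(eqrXn2 (ltn0Sn 1)) ?enorm_ge0 //; apply/eqP.
by rewrite -(vsubmxK z) symp_col_mx !enorm_col_mx_sqr enormN addrC.
Qed.

Lemma symp_exp (R : realType) (m j : nat) (nu : R) :
  (nu *: symp R m) ^+ j =
  (nu ^+ j * (-1) ^+ j./2) *: (if odd j then symp R m else 1%:M).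
Proof.
elim: j => [|j IH]; first by rewrite !expr0 mul1r scale1r.
rewrite exprS IH -[_ * _]/(_ *m _) -scalemxAr -scalemxAl scalerA /=.
rewrite uphalf_half [nu ^+ j.+1]exprS.
case: (odd j) => /=; last by rewrite add0n mulmx1; congr (_ *: _); ring.
rewrite add1n symp_sqr [(-1) ^+ j./2.+1]exprS scalerN -scaleNr; congr (_ *: _); ring.
Qed.

(* Matrices a + b J with J^2 = -1 multiply like complex numbers. *)
Lemma symp_cplx_exp (R : realType) (m T : nat) (a b : R) :
  exists a' b', (a%:M + b *: symp R m) ^+ T = a'%:M + b' *: symp R m /\
    a' ^+ 2 + b' ^+ 2 = (a ^+ 2 + b ^+ 2) ^+ T.
Proof.
elim: T => [|T [a' [b' [IH1 IH2]]]].
  by exists 1, 0; rewrite scale0r addr0 expr1n expr0n addr0 !expr0.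
exists (a * a' - b * b'), (a * b' + b * a'); rewrite exprS IH1; split; last first.
  by rewrite [RHS]exprS -IH2; ring.
rewrite -[_ * _]/(_ *m _) mulmxDr !mulmxDl -!scalemxAr -!scalemxAl symp_sqr.
rewrite -scalar_mxM mul_scalar_mx mul_mx_scalar !scalerN !scalerA scalemx1.
rewrite raddfB /= scalerDl [b' * b]mulrC [b' * a]mulrC.
by rewrite [X in _ + X = _]addrC addrACA; congr (_ + _); exact: addrC.
Qed.

(** * Error and residual polynomial of a 1-SCLI algorithm *)

(** The relation between $C_0$ and $N$ makes [zs] a fixed point of the iteration, so the error
    starts at $-z^*$ and is multiplied by $C_0$ at each step. *)
Lemma scli_error (R : realType) (n : nat) (alg : scli R n) (A : 'M[R]_n)
    (b zs : 'cV[R]_n) (t : nat) :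
    scli_C0 alg A = 1%:M + scli_N alg A *m A -> A *m zs + b = 0 ->
    scli_z0 alg = 0 ->
  scli_iter alg A b t = zs - scli_C0 alg A ^+ t *m zs.
Proof.
move=> C0E Az z0; elim: t => [|t IH]; first by rewrite /= z0 expr0 mul1mx subrr.
rewrite /= IH exprS -mulmxA mulmxBr.
have bE : b = - (A *m zs) by apply/eqP; rewrite -addr_eq0 addrC Az.
rewrite addrAC; congr (_ - _).
by rewrite C0E mulmxDl mul1mx bE mulmxN mulmxA addrK.
Qed.

(** Passing to the limit in the recursion shows that $-A^{-1} b$ is a fixed point for every $b$; as
    $b$ varies this determines $C_0$. *)
Lemma consistent_C0 (R : realType) (n : nat) (alg : scli R n) (A : 'M[R]_n) :
    A \in unitmx -> consistent_wrt alg A ->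
  scli_C0 alg A = 1%:M + scli_N alg A *m A.
Proof.
move=> Au Hc; set C := scli_C0 alg A; set N := scli_N alg A.
have fixp (b : 'cV[R]_n) :
    - (invmx A *m b) = C *m - (invmx A *m b) + N *m b.
  have coord (u : nat -> 'cV[R]_n) (l : 'cV[R]_n) i : u t @[t --> \oo] --> l ->
      (u t) i 0 @[t --> \oo] --> l i 0.
    by move=> ul; exact: (cvg_comp _ (fun v : 'cV[R]_n => v i 0) ul
      (@coord_continuous R n 1 i 0 _)).
  have cvb := Hc b; apply/colP => i.
  have cvS : (scli_iter alg A b t.+1) i 0 @[t --> \oo] -->
      (- (invmx A *m b)) i 0.
    by apply: coord; rewrite cvg_shiftS.
  suff : (scli_iter alg A b t.+1) i 0 @[t --> \oo] -->
      (C *m - (invmx A *m b) + N *m b) i 0 by exact: norm_cvg_unique cvS.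
  rewrite [X in _ --> X]mxE.
  under eq_fun do rewrite /= mxE.
  apply: cvgD; last exact: cvg_cst.
  rewrite [X in _ --> X]mxE; under eq_fun do rewrite mxE.
  apply: cvg_big => [|j _]; first exact: add_continuous.
  by apply: cvgMl_tmp; exact: coord.
have mxP (B1 B2 : 'M[R]_n) : (forall b : 'cV[R]_n, B1 *m b = B2 *m b) -> B1 = B2.
  by move=> H; apply/matrixP => i j; have /colP/(_ i) := H (delta_mx j 0);
    rewrite -!colE !mxE.
(* For $b = -A v$ the limit is $v$, and the fixed point equation reads $v = C v - N A v$. *)
apply: mxP => v; have := fixp (- (A *m v)).
rewrite !mulmxN mulKmx // !opprK => /esym/eqP; rewrite subr_eq => /eqP ->.
by rewrite mulmxDl mul1mx mulmxA.
Qed.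
(** As $J^2 = -1$, the power $(\nu J)^{j+1}$ is scalar exactly for odd $j$, where it equals $(-1)^h
    (\nu^2)^h$ with $h = (j+1)/2$. These terms form $p$, and $h \ge 1$ leaves its constant term
    equal to $1$. The terms with even $j$ are multiples of $J$ and go into $b$. *)
Lemma symp_residual_poly (R : realType) (m k : nat) (c : 'I_k -> R) :
  exists p : {poly R}, [/\ (size p <= k.+1)%N, p.[0] = 1 &
    forall nu : R, exists b : R,
      1%:M + (\sum_(j < k) c j *: (nu *: symp R m) ^+ j) *m (nu *: symp R m) =
      (p.[nu ^+ 2])%:M + b *: symp R m].
Proof.
pose q (j : 'I_k) : {poly R} :=
  if odd j then (c j * (-1) ^+ (uphalf j)) *: 'X^(uphalf j) else 0.
exists (1 + \sum_j q j); split.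
- rewrite (leq_trans (size_polyD _ _)) // geq_max size_poly1 /=.
  rewrite (leq_trans (size_sum _ _ _)) //; apply/bigmax_leqP => j _.
  rewrite /q; case: ifP => _; last by rewrite size_poly0.
  rewrite (leq_trans (size_scale_leq _ _)) // size_polyXn ltnS.
  by rewrite (leq_trans _ (ltn_ord j)) // leq_uphalf_double -addnn ltnW // leq_addr.
- rewrite hornerD hornerC horner_sum big1 ?addr0 // => j _.
  rewrite /q; case: ifP => [oj|_]; last by rewrite horner0.
  by rewrite hornerZ hornerXn uphalf_half oj add1n expr0n mulr0.
- move=> nu.
  exists (\sum_(j < k) (if odd j then 0 else c j * (nu ^+ j.+1 * (-1) ^+ (uphalf j)))).
  rewrite hornerD hornerC raddfD /= -addrA; congr (_ + _).
  rewrite horner_sum raddf_sum scaler_suml mulmx_suml -big_split /=.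
  apply: eq_bigr => j _; rewrite -scalemxAl -[_ *m _]/(_ * _) -exprSr.
  rewrite symp_exp scalerA /= /q; case oj: (odd j) => /=; last first.
    by rewrite horner0 raddf0 add0r.
  rewrite scale0r addr0 hornerZ hornerXn scalemx1; congr (_%:M).
  rewrite -mulrA -exprM mul2n uphalf_half oj add1n doubleS.
  rewrite (_ : j./2.*2.+2 = j.+1); last by rewrite -[in RHS](odd_double_half j) oj.
  by congr (_ * _); rewrite mulrC.
Qed.

(** * Hard bilinear instances *)

Lemma saddle_unitmx (R : realType) (m : nat) (nu : R) : nu != 0 ->
  saddle_mx (nu%:M : 'M[R]_m) \in unitmx.
Proof.
move=> nu0; rewrite saddle_scalar.
have /mulmx1_unit [] // : (nu *: symp R m) *m (- nu^-1 *: symp R m) = 1%:M.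
by rewrite -scalemxAl -scalemxAr symp_sqr scalerA mulrN divff // scaleN1r opprK.
Qed.

(** Centering at the zero of $F_f$ removes the linear terms, because there $b_1 = -M y^*$ and $b_2 =
    -M^\top x^*$. *)
Lemma bil_eval_saddle (R : realType) (m : nat) (f : Defs.bilinear R m)
    (x y xs ys : 'cV[R]_m) : bil_A f *m col_mx xs ys + bil_b f = 0 ->
  bil_eval f x y - bil_eval f xs ys =
  ((x - xs)^T *m bil_M f *m (y - ys)) 0 0.
Proof.
case: f => M b1 b2; rewrite /bil_A /bil_b /saddle_mx /bil_eval /=.
rewrite mul_block_col !mul0mx add0r addr0 add_col_mx.
rewrite -[0](@col_mx0 _ m m 1) => /eq_col_mx [e1 e2].
have -> : b1 = - (M *m ys) by apply/eqP; rewrite -addr_eq0 addrC e1.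
have -> : b2 = - (M^T *m xs).
  by apply/eqP; rewrite -addr_eq0 -oppr_eq0 opprD addrC -mulNmx e2.
(* Transposing $1 \times 1$ products brings every term to the form $u^\top M v$. *)
have e3 u : (- (M *m ys))^T *m u = - (u^T *m M *m ys)^T.
  by rewrite raddfN /= mulNmx !trmx_mul trmxK mulmxA.
have e4 u : (- (M^T *m xs))^T *m u = - (xs^T *m M *m u).
  by rewrite raddfN /= mulNmx trmx_mul trmxK.
have -> : (x - xs)^T = x^T - xs^T by rewrite raddfB.
rewrite !e3 !e4 !mulmxBl !mulmxBr.
move: (x^T *m M *m y) (xs^T *m M *m y) (x^T *m M *m ys) (xs^T *m M *m ys) => q1 q2 q3 q4.
rewrite !mxE.
ring.
Qed.

(* The error z_T - z* = - C0^T z* can be given any direction by the choice of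
   z*, as C0^T acts as multiplication by a complex number; along (e, e)
   all three losses are of the right order. *)
Lemma hard_instance (R : realType) (m : nat) (i : 'I_m) (L D nu a b : R)
    (alg : scli R (m + m)) (T : nat) :
    0 < D -> 0 < nu <= L -> a != 0 -> scli_z0 alg = 0 ->
    scli_C0 alg (saddle_mx nu%:M) =
      1%:M + scli_N alg (saddle_mx nu%:M) *m saddle_mx nu%:M ->
    scli_C0 alg (saddle_mx nu%:M) = a%:M + b *: symp R m ->
  exists f r, [/\ bil_class L D f, bil_M f = nu%:M,
    bil_A f *m bil_zstar f + bil_b f = 0, 0 < r /\ (a ^+ 2) ^+ T <= r ^+ 2 &
    scli_iter alg (bil_A f) (bil_b f) T = bil_zstar f +
      (r * D / Num.sqrt 2) *: col_mx (delta_mx i 0) (delta_mx i 0)].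
Proof.
move=> D0 /andP[nu0 nuL] a0 z00 C0E C0s.
have [a' [b' [CT abT]]] := symp_cplx_exp m T a b.
pose r := Num.sqrt (a' ^+ 2 + b' ^+ 2).
have a2T : 0 < (a ^+ 2) ^+ T by rewrite exprn_gt0 // exprn_even_gt0.
have aT : (a ^+ 2) ^+ T <= (a ^+ 2 + b ^+ 2) ^+ T.
  by rewrite lerXn2r ?nnegrE ?addr_ge0 ?sqr_ge0 // lerDl sqr_ge0.
have r2 : r ^+ 2 = a' ^+ 2 + b' ^+ 2.
  by rewrite sqr_sqrtr // addr_ge0 ?sqr_ge0.
have r20 : 0 < r ^+ 2 by rewrite r2 abT (lt_le_trans a2T).
have r0 : 0 < r by rewrite lt_neqAle sqrtr_ge0 andbT eq_sym -sqrf_eq0 gt_eqF.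
have s20 : 0 < Num.sqrt 2 :> R by rewrite sqrtr_gt0.
have s22 : Num.sqrt 2 ^+ 2 = 2 :> R by rewrite sqr_sqrtr.
(* Multiplication by $a' + b' J$ scales norms by $r$, and $(e, e)$ has norm $\sqrt 2$; an error
   $s\,(e, e)$ thus comes from a $z^*$ of norm $D$. *)
pose s := r * D / Num.sqrt 2.
have s0 : 0 < s by rewrite divr_gt0 // mulr_gt0.
pose e : 'cV[R]_m := delta_mx i 0.
pose w := col_mx e e.
(* The two blocks of $z^* = -s\,(a' + b' J)^{-1} w$: the inverse is $(a' - b' J) / r^2$, and $J w =
   (e, -e)$. *)
pose xs := - (s / r ^+ 2 * (a' - b')) *: e.
pose ys := - (s / r ^+ 2 * (a' + b')) *: e.
pose zs := col_mx xs ys.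
pose f := Defs.Bilinear (nu%:M) (- nu *: ys) (- nu *: xs).
have Au : bil_A f \in unitmx by apply: saddle_unitmx; rewrite gt_eqF.
have Az : bil_A f *m zs + bil_b f = 0.
  rewrite /bil_A /= saddle_scalar -scalemxAl symp_col_mx /bil_b /=.
  by rewrite scale_col_mx add_col_mx !scaleNr opprK scalerN subrr addNr col_mx0.
have zsE : bil_zstar f = zs.
  have bE : bil_b f = - (bil_A f *m zs).
    by apply/eqP; rewrite -addr_eq0 addrC Az.
  by rewrite /bil_zstar bE mulmxN mulKmx // opprK.
have zsn : enorm zs = D.
  apply/eqP; rewrite -(eqrXn2 (ltn0Sn 1)) ?enorm_ge0 ?(ltW D0) //.
  rewrite enorm_col_mx_sqr !enormZ enorm_delta_mx !mulr1 !real_normK ?num_real //.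
  apply/eqP; rewrite !sqrrN !exprMn -mulrDr.
  rewrite (_ : (a' - b') ^+ 2 + (a' + b') ^+ 2 = 2 * r ^+ 2); last first.
    by rewrite r2; ring.
  rewrite exprVn s22; field.
  by rewrite gt_eqF.
exists f, r; rewrite zsE; split => //.
- split.
  + move=> z z'; rewrite !bil_opE opprD addrACA subrr addr0 -mulmxBr.
    rewrite /bil_A /= saddle_scalar -scalemxAl enormZ enorm_symp (gtr0_norm nu0).
    by rewrite ler_wpM2r ?enorm_ge0.
  + by rewrite /= -scalemx1 mxrank_scale_nz ?mxrank1 // gt_eqF.
  + by rewrite -enormN -/(bil_zstar f) zsE.
- by split=> //; rewrite r2 abT.
- rewrite (scli_error _ C0E Az) // C0s CT; congr (_ + _).
  have rs : s / r ^+ 2 * (a' ^+ 2 + b' ^+ 2) = s.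
    by rewrite -r2 divfK // gt_eqF.
  rewrite -/s mulmxDl mul_scalar_mx -scalemxAl symp_col_mx.
  rewrite !scale_col_mx add_col_mx opp_col_mx -rs.
  by congr (col_mx _ _); apply/colP => j; rewrite !mxE; ring.
Qed.

(** * The losses for an error along the diagonal *)

Lemma addrKC (V : zmodType) (u v : V) : u + v - u = v.
Proof. by rewrite addrAC subrr add0r. Qed.

Lemma enorm_diag (R : realType) (m : nat) (i : 'I_m) :
  enorm (col_mx (delta_mx i 0) (delta_mx i 0) : 'cV[R]_(m + m)) ^+ 2 = 2.
Proof. by rewrite enorm_col_mx_sqr !enorm_delta_mx expr1n. Qed.

Lemma loss_ham_diag (R : realType) (m : nat) (i : 'I_m) (nu s : R)
    (f : Defs.bilinear R m) :
    bil_M f = nu%:M -> bil_A f *m bil_zstar f + bil_b f = 0 ->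
  loss_ham f (bil_zstar f + s *: col_mx (delta_mx i 0) (delta_mx i 0)) =
  2 * (nu * s) ^+ 2.
Proof.
move=> Mf Az; rewrite /loss_ham bil_opE mulmxDr addrAC Az add0r.
rewrite /bil_A Mf saddle_scalar -scalemxAr -scalemxAl scalerA enormZ enorm_symp.
by rewrite exprMn enorm_diag real_normK ?num_real // mulrC [s * nu]mulrC.
Qed.

Section DiagonalError.
Variables (R : realType) (m : nat) (i : 'I_m) (nu s : R) (f : Defs.bilinear R m).
Hypotheses (Mf : bil_M f = nu%:M)
           (Az : bil_A f *m bil_zstar f + bil_b f = 0).
Let w : 'cV[R]_(m + m) := col_mx (delta_mx i 0) (delta_mx i 0).
Let z := bil_zstar f + s *: w.
Let xs := usubmx (bil_zstar f).
Let ys := dsubmx (bil_zstar f).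

Let xE : usubmx z = xs + s *: delta_mx i 0.
Proof. by rewrite /z /w linearD linearZ /= col_mxKu. Qed.

Let yE : dsubmx z = ys + s *: delta_mx i 0.
Proof. by rewrite /z /w linearD linearZ /= col_mxKd. Qed.

Let evalE x y :
  bil_eval f x y = bil_eval f xs ys + nu * ((x - xs)^T *m (y - ys)) 0 0.
Proof.
apply/eqP; rewrite addrC -subr_eq (@bil_eval_saddle _ _ f x y xs ys).
  by rewrite Mf mul_mx_scalar -scalemxAl mxE.
by rewrite vsubmxK.
Qed.

Let evalx y : bil_eval f (usubmx z) y = bil_eval f xs ys + nu * s * (y - ys) i 0.
Proof.
rewrite evalE xE addrKC linearZ /= -scalemxAl mxE mulrA trmx_delta -rowE.
by rewrite [(row _ _) _ _]mxE.
Qed.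

Let evaly x : bil_eval f x (dsubmx z) = bil_eval f xs ys + nu * s * (x - xs) i 0.
Proof.
rewrite evalE yE addrKC -scalemxAr mxE mulrA -colE.
by rewrite !mxE.
Qed.

Lemma loss_func_diag : loss_func f z = `|nu * s ^+ 2|.
Proof.
rewrite /loss_func evalx yE -/xs -/ys addrKC addrKC !mxE !eqxx mulr1.
by rewrite -mulrA.
Qed.

(** With $x - x^* = y - y^* = s e$, both partial functions are affine in a single coordinate with
    slope $\nu s$. The points $y^* + D e$ and $x^* - D e$ each contribute $\nu s D$. *)
Lemma loss_gap_diag (D : R) : 0 <= D -> 0 <= nu * s ->
  2 * (nu * s * D) <= loss_gap D f z.
Proof.
move=> D0 ns; rewrite /loss_gap -/xs -/ys.
have dn c : enorm (c *: delta_mx i 0 : 'cV[R]_m) = `|c|.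
  by rewrite enormZ enorm_delta_mx mulr1.
have up : bil_eval f xs ys + nu * s * D <=
    sup [set bil_eval f (usubmx z) y' | y' in [set y' | enorm (y' - ys) <= D]].
  apply: ub_le_sup.
    (* An upper bound of the set ensures that [sup] is a true supremum and not its default value;
       the same is done below for [inf]. *)
    exists (bil_eval f xs ys + nu * s * D) => _ [y' /= yD <-].
    rewrite evalx lerD2l ler_wpM2l // (le_trans (ler_norm _)) //.
    exact: le_trans (coord_le_enorm i _) yD.
  exists (ys + D *: delta_mx i 0) => /=; rewrite ?evalx addrKC.
    by rewrite dn ger0_norm.
  by rewrite !mxE !eqxx mulr1.
have lo : inf [set bil_eval f x' (dsubmx z) | x' in [set x' | enorm (x' - xs) <= D]]
    <= bil_eval f xs ys - nu * s * D.
  apply: ge_inf.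
    exists (bil_eval f xs ys - nu * s * D) => _ [x' /= xD <-].
    rewrite evaly lerD2l -mulrN ler_wpM2l // lerNl.
    rewrite (le_trans (ler_norm _)) // normrN.
    exact: le_trans (coord_le_enorm i _) xD.
  exists (xs + (- D) *: delta_mx i 0) => /=; rewrite ?evaly addrKC.
    by rewrite dn normrN ger0_norm.
  by rewrite !mxE !eqxx mulr1 mulrN.
lra.
Qed.
End DiagonalError.

(** * Lower bounds on the iteration complexity *)

Lemma IC_ge (R : realType) (m : nat) (L D : R) (alg : scli R (m + m))
    (loss : Defs.bilinear R m -> 'cV[R]_(m + m) -> R) (T : nat) (f : Defs.bilinear R m)
    (c : R) :
    bil_class L D f -> c <= loss f (scli_iter alg (bil_A f) (bil_b f) T) ->
  (c%:E <= IC L D alg loss T)%E.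
Proof.
move=> fL cl; apply: le_ereal_sup_tmp.
by exists (loss f (scli_iter alg (bil_A f) (bil_b f) T))%:E; [exists f|rewrite lee_fin].
Qed.

(** Joins the polynomial bound, for $B = L^2$ and $y = \nu^2$, to the hard instance. The exponent
    [N] is kept apart from the time [T] because the function value loss calls for $N = 2T$. *)
Lemma scli_hard_instance (R : realType) (m : nat) (i : 'I_m) (L D : R) (k : nat)
    (alg : scli R (m + m)) (N T : nat) :
    0 < L -> 0 < D -> (0 < k)%N -> (0 < N)%N ->
    (forall M : 'M[R]_m, \rank (saddle_mx M) = (m + m)%N ->
      scli_C0 alg (saddle_mx M) =
      1%:M + scli_N alg (saddle_mx M) *m saddle_mx M) ->
    scli_z0 alg = 0 -> inversion_poly alg k ->
  exists f nu r a, [/\ bil_class L D f, bil_M f = nu%:M,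
    bil_A f *m bil_zstar f + bil_b f = 0,
    [/\ 0 < nu, 0 < r, (a ^+ 2) ^+ T <= r ^+ 2 &
      L ^+ 2 / (20%:R * N%:R * k%:R ^+ 2) <= nu ^+ 2 * (a ^+ 2) ^+ N] &
    scli_iter alg (bil_A f) (bil_b f) T = bil_zstar f +
      (r * D / Num.sqrt 2) *: col_mx (delta_mx i 0) (delta_mx i 0)].
Proof.
move=> L0 D0 k0 N0 HC z00 [c Nc].
have [p [szp p0 pE]] := symp_residual_poly m c.
have L20 : 0 < L ^+ 2 by rewrite exprn_gt0.
have [y /andP[y0 yL] Hy] := poly_power_lower_bound k0 N0 L20 szp p0.
pose nu := Num.sqrt y.
have nu2 : nu ^+ 2 = y by rewrite sqr_sqrtr // ltW.
have nu0 : 0 < nu by rewrite sqrtr_gt0.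
have nuL : nu <= L by rewrite -(ler_pXn2r (ltn0Sn 1)) ?nnegrE ?(ltW nu0) ?(ltW L0) // nu2.
have C0E := HC nu%:M (mxrank_unit (saddle_unitmx m (lt0r_neq0 nu0))).
have [b bE] := pE nu.
(* A zero value would make the lower bound [Hy] collapse to $0$, as $N > 0$. *)
have a0 : p.[nu ^+ 2] != 0.
  apply/eqP => a0; move: Hy; rewrite -nu2 a0 expr0n /= expr0n.
  rewrite (gtn_eqF N0) mulr0 leNgt divr_gt0 //.
  by rewrite !mulr_gt0 ?exprn_gt0 ?ltr0n.
have [||f [r [fL Mf Az [r0 rT] zT]]] := @hard_instance R m i L D nu _ b alg T D0 _ a0 z00 C0E.
- by rewrite nu0.
- by rewrite C0E Nc saddle_scalar.
by exists f, nu, r, p.[nu ^+ 2]; split=> //; split=> //; rewrite nu2.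
Qed.

Theorem theorem9 (R : realType) (m : nat) (hm : (0 < m)%N) (L D : R)
    (hL : 0 < L) (hD : 0 < D) (k : nat) (hk : (0 < k)%N)
    (alg : scli R (m + m))
    (halg : consistent alg \/
            (forall M : 'M[R]_m, \rank (saddle_mx M) = (m + m)%N ->
               scli_C0 alg (saddle_mx M) =
               1%:M + scli_N alg (saddle_mx M) *m saddle_mx M))
    (hz0 : scli_z0 alg = 0)
    (hN : inversion_poly alg k)
    (T : nat) (hT : (1 <= T)%N) :
  [/\ ((L ^+ 2 * D ^+ 2 / (20%:R * T%:R * k%:R ^+ 2))%:E
         <= IC L D alg (@loss_ham R m) T)%E,
      ((L * D ^+ 2 / (k%:R * Num.sqrt (20%:R * T%:R)))%:E
         <= IC L D alg (@loss_gap R m D) T)%E &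
      ((L * D ^+ 2 / (36%:R * k%:R * Num.sqrt T%:R))%:E
         <= Order.max (IC L D alg (@loss_func R m) T)
                      (IC L D alg (@loss_func R m) (2 * T)%N))%E].
Proof.
have HC : forall M : 'M[R]_m, \rank (saddle_mx M) = (m + m)%N ->
    scli_C0 alg (saddle_mx M) = 1%:M + scli_N alg (saddle_mx M) *m saddle_mx M.
  case: halg => // cons M rM; apply: consistent_C0; last exact: cons.
  by rewrite -row_free_unit /row_free rM.
pose i := Ordinal hm.
have k0 : 0 < k%:R :> R by rewrite ltr0n.
have T0 : 0 < T%:R :> R by rewrite ltr0n.
have s20 : 0 < Num.sqrt 2 :> R by rewrite sqrtr_gt0.
have s22 : Num.sqrt 2 ^+ 2 = 2 :> R by rewrite sqr_sqrtr.
have s21 : 1 < Num.sqrt 2 :> R by rewrite -[ltLHS]sqrtr1 ltr_sqrt //; lra.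
have [f [nu [r [a [fL Mf Az [nu0 r0 aT Ha] zT]]]]] :=
  scli_hard_instance i T hL hD hk hT HC hz0 hN.
have nur : L ^+ 2 / (20%:R * T%:R * k%:R ^+ 2) <= (nu * r) ^+ 2.
  by rewrite (le_trans Ha) // [(nu * r) ^+ 2]exprMn ler_wpM2l // sqr_ge0.
split.
- apply: (IC_ge fL); rewrite zT (loss_ham_diag _ _ Mf Az).
  rewrite (_ : 2 * _ = (nu * r) ^+ 2 * D ^+ 2); last first.
    by rewrite !exprMn exprVn s22; field.
  by rewrite mulrAC ler_wpM2r // sqr_ge0.
- apply: (IC_ge fL); rewrite zT.
  rewrite (le_trans _ (loss_gap_diag i Mf Az (ltW hD) _)) //; last first.
    by rewrite ltW // !mulr_gt0 // invr_gt0.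
  rewrite (_ : 2 * _ = Num.sqrt 2 * (nu * r) * D ^+ 2); last first.
    by rewrite -{1}s22; field; rewrite gt_eqF.
  rewrite mulrAC ler_wpM2r ?sqr_ge0 //.
  (* The spare factor $\sqrt 2 \ge 1$ is dropped. *)
  apply: (@le_trans _ _ (nu * r)); last first.
    by rewrite ler_peMl ?mulr_ge0 ?ltW.
  rewrite -(ler_pXn2r (ltn0Sn 1)) ?nnegrE ?mulr_ge0 ?invr_ge0 ?sqrtr_ge0 ?(ltW hL) ?(ltW nu0)
    ?(ltW r0) ?mulr_ge0 ?sqrtr_ge0 ?(ltW k0) //.
  rewrite (le_trans _ nur) // expr_div_n exprMn sqr_sqrtr ?mulr_ge0 ?(ltW T0) //.
  by rewrite [k%:R ^+ 2 * _]mulrC.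
- have hT2 : (0 < 2 * T)%N by rewrite muln_gt0.
  (* This loss is linear in $\nu$ and quadratic in the error, so it is bounded through its square,
     which involves $\nu^2 (a^2)^{2T}$: hence the exponent $2T$ at time $T$. *)
  have [g [nu' [r' [a' [gL Mg Bz [nu'0 r'0 a'T Ha'] z'T]]]]] :=
    scli_hard_instance i T hL hD hk hT2 HC hz0 hN.
  rewrite le_max; apply/orP; left; apply: (IC_ge gL).
  rewrite z'T (loss_func_diag _ _ Mg Bz) ger0_norm; last first.
    by rewrite pmulr_rge0 ?sqr_ge0.
  rewrite (_ : nu' * _ = nu' * r' ^+ 2 / 2 * D ^+ 2); last first.
    by rewrite !exprMn exprVn s22; field.
  rewrite mulrAC ler_wpM2r ?sqr_ge0 //.
  rewrite -(ler_pXn2r (ltn0Sn 1)) ?nnegrE ?mulr_ge0 ?invr_ge0 ?mulr_ge0 ?sqrtr_ge0 ?sqr_ge0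
    ?(ltW hL) ?(ltW nu'0) ?(ltW r'0) ?(ltW k0) //.
  have : L ^+ 2 / (20%:R * (2 * T)%:R * k%:R ^+ 2) <= nu' ^+ 2 * (r' ^+ 2) ^+ 2.
    rewrite (le_trans Ha') // ler_wpM2l ?sqr_ge0 // mulnC exprM.
    by rewrite lerXn2r ?nnegrE ?(exprn_ge0 T (sqr_ge0 a')) ?sqr_ge0.
  rewrite !expr_div_n !exprMn sqr_sqrtr ?(ltW T0) // natrM.
  set W := nu' ^+ 2 * _ => HW.
  rewrite (le_trans _ (ler_wpM2r _ HW)) ?invr_ge0 ?sqr_ge0 //.
  (* The constants compare as $20 \cdot 2 \cdot 2^2 = 160 \le 36^2$. *)
  rewrite -[leRHS]mulrA ler_wpM2l ?sqr_ge0 // -invfM lef_pV2 ?posrE ?mulr_gt0 ?exprn_gt0 //.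
  have : 0 < k%:R ^+ 2 * T%:R :> R by rewrite mulr_gt0 ?exprn_gt0.
  lra.
Qed.
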